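(* Let $G$ be a ribbon graph and $D(G)$ be its ribbon-graphic delta-matroid. Then $$P(G;\lambda) = \lambda^{k(G)}\,P(D(G);\lambda),$$ where $k(G)$ is the number of connected components of $G$, the left-hand side uses the Penrose polynomial of a ribbon graph, and the right-hand side uses the Penrose polynomial of a vf-safe delta-matroid.
   Context: A ribbon graph $G=(V(G),E(G))$ is a surface with boundary represented as the union of two (finite) sets of discs, a set $V(G)$ of vertices and a set $E(G)$ of edges, such that: the vertices and edges intersect in disjoint line segments; each such line segment lies on the boundary of precisely one vertex and precisely one edge; and every edge contains exactly two such line segments. $f(G)$ denotes the number of boundary components of $G$. For $A\subseteq E(G)$ the partial Petrial $G^{\tau(A)}$ is obtained from $G$ by, for each $e\in A$, choosing one of the two arcs where $e$ meets a vertex, detaching $e$ along that arc, and reattaching it with the direction of the arc reversed (adding a half-twist to $e$). Penrose polynomial of a ribbon graph: $P(G;\lambda)=\sum_{A\subseteq E(G)}(-1)^{|A|}\lambda^{f(G^{\tau(A)})}$. A quasi-tree is a ribbon graph with exactly one boundary component. The delta-matroid of $G$ is $D(G)=(E(G),\mathcal{F})$ where $\mathcal{F}$ consists of the edge sets of the spanning ribbon subgraphs of $G$ that form a quasi-tree when restricted to each connected component of $G$. A set system is a pair $D=(E,\mathcal{F})$ with $E$ a finite set and $\mathcal{F}$ a collection of subsets of $E$ (feasible sets). A delta-matroid is a set system with $\mathcal{F}\ne\emptyset$ such that for all $X,Y\in\mathcal{F}$ and $u\in X\bigtriangleup Y$ there is $v\in X\bigtriangleup Y$ (possibly $v=u$)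 with $X\bigtriangleup\{u,v\}\in\mathcal{F}$, where $\bigtriangleup$ is symmetric difference. For $A\subseteq E$ the twist is $D*A=(E,\{A\bigtriangleup X:X\in\mathcal{F}\})$. For $e\in E$, $D+e=(E,\mathcal{F}\bigtriangleup\{F\cup\{e\}:F\in\mathcal{F},e\notin F\})$, and $D+\{e_1,\dots,e_n\}=D+e_1+\cdots+e_n$ (loop complementation; order immaterial). The dual pivot is $D\bar{*}A=((D*A)+A)*A$. Operations are applied from left to right. A delta-matroid is vf-safe if every sequence of twists and loop complementations applied to it results in a delta-matroid; delta-matroids of ribbon graphs are known to be vf-safe. $d_D$ denotes the rank of the lower matroid $D_{\min}$, i.e. the minimum cardinality of a feasible set of $D$. Penrose polynomial of a vf-safe delta-matroid $D=(E,\mathcal{F})$: $P(D;\lambda)=\sum_{X\subseteq E}(-1)^{|X|}\lambda^{d_{D*E\bar{*}X}}$. *)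

(* Defs.v *)
From mathcomp Require Import all_boot all_order all_algebra.

Set Implicit Arguments.
Unset Strict Implicit.
Unset Printing Implicit Defensive.

Import GRing.Theory.

(* Combinatorial ribbon graphs.  An edge disc e is a rectangle that meets the
   vertex discs in two opposite sides, the line segments (e, false) and
   (e, true).  The segment h has the two endpoints (h, false) and (h, true),
   the corners of the rectangle; they are named so that the two remaining
   (free) sides of e join ((e, false), s) to ((e, true), s), for s : bool. *)
Notation segment E := (E * bool)%type.
Notation corner E := (segment E * bool)%type.

Section Corners.
Variable E : finType.
Implicit Types (c : corner E) (A : {set E}).

Definition seg_end c : corner E := (c.1, ~~ c.2).
Definition side_end c : corner E := ((c.1.1, ~~ c.1.2), c.2).

(* Exchange of the two endpoints of the segment (e, true), for all e in A. *)
Definition flip A c : corner E :=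
  (c.1, if (c.1.1 \in A) && c.1.2 then ~~ c.2 else c.2).

Lemma flipK A : involutive (flip A).
Proof.
by case=> [[e i] s]; rewrite /flip /=; case: (_ && _); rewrite ?negbK.
Qed.

Lemma flip_seg_end A c : flip A (seg_end c) = seg_end (flip A c).
Proof. by case: c => [[e i] s]; rewrite /flip /seg_end /=; case: ifP. Qed.

(* The boundary circle of a vertex disc alternates between line segments and
   vertex arcs; [varc] maps a corner to the other endpoint of the vertex arc
   that starts there. *)
Definition vertex_bdry (varc : corner E -> corner E) : rel (corner E) :=
  [rel c d | (d == seg_end c) || (d == varc c)].

End Corners.

(* [vertexP]: the segments on one vertex disc are those on one circle, since a
   disc has a single boundary circle.  A vertex that carries no segment is not
   in the range of [vertex]. *)
Record ribbon_graph (V E : finType) := RibbonGraph {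
  vertex : segment E -> V;
  varc : corner E -> corner E;
  varcK : involutive varc;
  varc_neq : forall c, varc c != c;
  vertexP : forall c d,
    (vertex c.1 == vertex d.1) = connect (vertex_bdry varc) c d
}.

Section RibbonGraph.
Variables V E : finType.
Implicit Types (G : ribbon_graph V E) (A : {set E}) (W : {set V}).

Section PartialPetrial.
Variables (G : ribbon_graph V E) (A : {set E}).

(* The segment (e, true) of each e in A is detached, and reattached with its
   direction reversed. *)
Definition petrial_arc (c : corner E) : corner E := flip A (varc G (flip A c)).

Lemma petrial_arcK : involutive petrial_arc.
Proof. by move=> c; rewrite /petrial_arc flipK varcK flipK. Qed.

Lemma petrial_arc_neq c : petrial_arc c != c.
Proof.
by rewrite -{2}[c](flipK A) (inj_eq (inv_inj (flipK A))) varc_neq.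
Qed.

Lemma petrial_vertexP c d :
  (vertex G c.1 == vertex G d.1) = connect (vertex_bdry petrial_arc) c d.
Proof.
have step x y : vertex_bdry petrial_arc x y
                = vertex_bdry (varc G) (flip A x) (flip A y).
  rewrite /vertex_bdry /= /petrial_arc -flip_seg_end.
  rewrite (inj_eq (inv_inj (flipK A))).
  by rewrite -(inj_eq (inv_inj (flipK A)) y (flip A _)) flipK.
have lift (r r' : rel (corner E)) :
    (forall x y, r x y -> r' (flip A x) (flip A y)) ->
  forall x y, connect r x y -> connect r' (flip A x) (flip A y).
  move=> rr' x y /connectP[p rp ->] {y}.
  elim: p x rp => [|z p IHp] x /= => [_|/andP[xz /IHp]]; first exact: connect0.
  by apply: connect_trans; apply/connect1/rr'.
rewrite (_ : connect _ c d
             = connect (vertex_bdry (varc G)) (flip A c) (flip A d)).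
  by rewrite -vertexP.
apply/idP/idP; first by apply: lift => x y; rewrite step.
move=> cd; rewrite -[c](flipK A) -[d](flipK A).
by apply: lift cd => x y; rewrite step !flipK.
Qed.

Definition partial_petrial : ribbon_graph V E :=
  RibbonGraph petrial_arcK petrial_arc_neq petrial_vertexP.

End PartialPetrial.

Definition adjacent G : rel V :=
  [rel v w | [exists h : segment E,
                (vertex G h == v) && (vertex G (h.1, ~~ h.2) == w)]].

Definition component G (v : V) : {set V} := [set w | connect (adjacent G) v w].

Definition num_components G : nat := n_comp (adjacent G) [set: V].

(* The boundary of the spanning ribbon subgraph with edge set A consists of the
   vertex arcs of G, the free sides of the edges in A, and the segments of the
   edges outside A, which are exposed when these edges are removed. *)
Definition sub_bdry G A : rel (corner E) :=
  [rel c d | (d == varc G c)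
             || (d == if c.1.1 \in A then side_end c else seg_end c)].

(* Number of boundary components of the ribbon subgraph with vertex set W whose
   edges are the edges in A with both ends in W.  It is only meant for a union
   W of connected components of G.  Each vertex without segments contributes
   its own boundary circle. *)
Definition sub_num_bdry G W A : nat :=
  n_comp (sub_bdry G A) [pred c | vertex G c.1 \in W]
  + #|[set v in W | v \notin codom (vertex G)]|.

Definition num_bdry G : nat := sub_num_bdry G [set: V] [set: E].

Definition delta_matroid_of G : {set {set E}} :=
  [set A : {set E} | [forall v, sub_num_bdry G (component G v) A == 1]].

End RibbonGraph.

(* A set system on E is given by its collection of feasible sets. *)
Section SetSystem.
Variable E : finType.
Implicit Types (D : {set {set E}}) (A X : {set E}).

Definition symdiff (T : finType) (X Y : {set T}) : {set T} :=
  (X :\: Y) :|: (Y :\: X).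

Definition twist D A : {set {set E}} := [set symdiff A X | X in D].

Definition loop_compl1 D (e : E) : {set {set E}} :=
  symdiff D [set e |: F | F in D & e \notin F].

Definition loop_compl D A : {set {set E}} := foldl loop_compl1 D (enum A).

Definition dual_pivot D A : {set {set E}} :=
  twist (loop_compl (twist D A) A) A.

(* The default value #|E| only matters if D has no feasible set. *)
Definition min_rank D : nat := \big[minn/#|E|]_(F in D) #|F|.

End SetSystem.

Local Open Scope ring_scope.

(* The variable lambda is 'X. *)
Definition penrose_ribbon (V E : finType) (G : ribbon_graph V E) : {poly int} :=
  \sum_(A : {set E}) (-1) ^+ #|A| * 'X^(num_bdry (partial_petrial G A)).

(* The formula makes sense for every set system; it is the Penrose polynomial
   when D is a vf-safe delta-matroid. *)
Definition penrose_delta (E : finType) (D : {set {set E}}) : {poly int} :=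
  \sum_(X : {set E})
    (-1) ^+ #|X| * 'X^(min_rank (dual_pivot (twist D [set: E]) X)).

(* Main.v *)
Require Import Defs.
From mathcomp Require Import all_boot all_order all_algebra.

(** The identity holds term by term.  Fix [A] and write [G'] for the partial
    Petrial of [G] along [A] and [k] for the number of components, which [G]
    and [G'] share.  On the edges of [A] the operations in the exponent compose
    to a loop complementation followed by a twist, on the other edges to a twist
    alone, so that [dual_pivot (twist D E) A = twist (loop_compl D A) E]
    ([dual_pivot_twistT]).  Loop complementation of [D(G)] is partial Petriality
    of [G] ([loop_compl_delta_matroid]).  What remains is
    [f(G') = k + min #|E \ F|], over the feasible sets [F] of [D(G')]
    ([min_rank_dual]).

    All the topology is in one local statement, [edge_resolutions].  Around an
    edge [e] of [F], the three boundaries given by [F], by [F] without [e], and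
    by [F] after a half-twist of [e] differ only in how they join the four
    corners of [e]: they use the three perfect matchings of these corners.  The
    rest of the boundary consists of circles and of two paths, which already
    match the four corners in one of these three ways.  The resolution that
    agrees with this pairing closes the paths into two circles; each of the
    others joins them into one.  The three numbers of circles are therefore
    [n + 1], [n] and [n] in some order.

    A set is feasible iff its boundary has exactly [k] circles, and no boundary
    has fewer ([feasible_leqif]).  Hence, of the three boundaries above, none or
    exactly two have [k] circles ([k <= n] in all cases), which is the rule for
    the feasible sets of [D + e] ([mem_petrial1]).  Moreover, deleting an edge
    changes the number of circles by at most one, so a feasible set misses at
    least [f(G') - k] edges.  Equality is attained by greedily deleting edges
    with two different boundary circles along their sides
    ([feasible_greedy]). *)

Set Implicit Arguments.
Unset Strict Implicit.
Unset Printing Implicit Defensive.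

Import fingraph.

(** * Components of relations, and of pairs of involutions *)

Section Components.
Variable T : finType.
Implicit Types (e r : rel T) (a b : T -> T) (x y : T).
Local Open Scope nat_scope.

Lemma connect_invariant (S : Type) (h : T -> S) e :
  (forall x y, e x y -> h x = h y) -> forall x y, connect e x y -> h x = h y.
Proof.
move=> eh x y /connectP[p]; elim: p x => [|z p IHp] x /=; first by move=> _ ->.
by case/andP=> /eh-> /IHp.
Qed.

(** Adding edges that all run within the union of two distinct classes, and that
    connect them, merges these classes and nothing else.  The edges added may be
    several: a resolution of an edge disc adds two of them at once. *)
Lemma n_comp_merge e r (p q : T) :
    connect_sym e -> connect_sym r -> subrel e (connect r) ->
    connect r p q -> ~~ connect e p q ->
    (forall x y, r x y -> connect e x y
       \/ [/\ connect e p x || connect e q x & connect e p y || connect e q y]) ->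
  n_comp e predT = (n_comp r predT).+1.
Proof.
move=> se sr er rpq npq re.
(* [h] sends the class of [q] to the class of [p]; it labels the merged classes,
   and its image is the set of roots of [e] other than that of [q]. *)
pose h x := if root e x == root e q then root e p else root e x.
have eh x y : connect e x y -> h x = h y.
  by move=> /(rootP se) exy; rewrite /h exy.
have hpq x : connect e p x || connect e q x -> h x = root e p.
  case/orP=> /(rootP se); rewrite /h => <-; last by rewrite eqxx.
  by case: ifP.
have rh x y : connect r x y -> h x = h y.
  move: x y; apply: connect_invariant => x y /re[/eh//|[/hpq-> /hpq-> //]].
have er' : subrel (connect e) (connect r) by apply: connect_sub.
have hr x : connect r x (h x).
  rewrite /h; case: ifP => [/eqP/(rootP se)/er' xq|_]; last first.
    exact/er'/connect_root.
  apply: connect_trans xq _; rewrite sr; apply: connect_trans rpq.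
  by rewrite sr; apply/er'/connect_root.
have hh x : root e (h x) = h x by rewrite /h; case: ifP => _; apply: root_root.
have hq x : h x != root e q.
  by rewrite /h; case: ifP => [_|/negbT//]; rewrite root_connect.
rewrite /n_comp_mem (cardD1 (root e q)) inE /= roots_root //= add1n.
congr _.+1; rewrite -(@card_in_imset _ _ (root r)).
  apply: eq_card => x; rewrite !inE andbT; apply/imsetP/idP => [[y _ ->]|rx].
    exact: roots_root.
  exists (h x); last by rewrite -(eqP rx); apply/(rootP sr); rewrite (eqP rx).
  by rewrite !inE hq andbT; apply/eqP/hh.
move=> x y; rewrite !inE => /and3P[xq /eqP ex _] /and3P[yq /eqP ey _].
by move/(rootP sr)/rh; rewrite /h ex ey (negPf xq) (negPf yq).
Qed.

Lemma n_comp_conj (h : T -> T) e r :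
    connect_sym e -> connect_sym r -> involutive h ->
    (forall x y, r x y = e (h x) (h y)) ->
  n_comp r predT = n_comp e predT.
Proof.
move=> se sr hK rh.
have cT : closed e predT by [].
rewrite [RHS](adjunction_n_comp h se sr cT) //.
apply: (strict_adjunction sr cT (inv_inj hK)).
  by apply/subsetP => x _; rewrite -[x]hK codom_f.
by move=> x y _; rewrite rh.
Qed.

(** If [a] and [b] are fixed point free, the classes are alternating cycles, the
    boundary circles below; a fixed point of [b] is the end of a path. *)
Definition pair_rel a b : rel T := [rel x y | (y == a x) || (y == b x)].

Lemma pair_rel_sym a b :
  involutive a -> involutive b -> connect_sym (pair_rel a b).
Proof.
move=> aK bK; apply: sym_connect_sym => x y; rewrite /pair_rel /=.
by rewrite [y == a x]eq_sym [y == b x]eq_sym (inv_eq aK) (inv_eq bK).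
Qed.

(** A path that starts at a fixed point [p] of [b] has exactly one other end.
    Since [b p = p], the whole class of [p] is the orbit of [p] under [a \o b],
    on which [b] acts as the reflection [i |-> - i] of the exponents modulo the
    orbit size [n].  This reflection fixes [0] and, for [n] even, [n / 2]; for
    odd [n] the map [a], which acts as [i |-> 1 - i], would have a fixed point. *)
Section Partner.
Variables (a b : T -> T) (p : T).
Hypotheses (aK : involutive a) (bK : involutive b).
Hypotheses (aN : forall x, a x != x) (bp : b p = p).

Let g := a \o b.
Let gI : injective g. Proof. exact: inj_comp (inv_inj aK) (inv_inj bK). Qed.

Let b_iter i : iter i g (b (iter i g p)) = p.
Proof.
elim: i => // i IHi; rewrite iterSr iterS -[RHS]IHi; congr (iter i g _).
by set x := iter i g p; rewrite /g /= bK aK.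
Qed.

Let reach x : connect (pair_rel a b) p x -> exists i, x = iter i g p.
Proof.
case/connectP=> s.
elim/last_ind: s x => [|s y IHs] x /=; first by move=> _ ->; exists 0.
rewrite rcons_path last_rcons => /andP[ps sy] ->{x}.
have [i li] := IHs _ ps erefl.
have [j bj] : exists j, b (iter i g p) = iter j g p.
  have := fconnect_iter g i (b (iter i g p)); rewrite b_iter.
  rewrite fconnect_sym // => /iter_findex <-.
  by exists (findex g p (b (iter i g p))).
move: sy; rewrite li => /orP[]/eqP->; last by exists j.
by exists j.+1; rewrite iterS -bj; set x := iter i g p; rewrite /g /= bK.
Qed.

Let n := order g p.

Let fixed_iter i : i < n -> b (iter i g p) = iter i g p -> i = 0 \/ i.*2 = n.
Proof.
move=> lin bi; have := b_iter i; rewrite bi -iterD addnn => ip.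
case: (ltnP i.*2 n) => [lt|le].
  have := findex_iter lt; rewrite ip findex0 => /esym/eqP.
  by rewrite double_eq0 => /eqP; left.
have lt : i.*2 - n < n by rewrite ltn_subLR // addnn ltn_double.
right; apply/eqP; rewrite eqn_leq le andbT -subn_eq0; apply/eqP.
rewrite -[LHS](findex_iter lt) -{2}(iter_order gI p) -iterD subnK // ip.
exact: findex0.
Qed.

Lemma partner_uniq x y :
    b x = x -> b y = y -> x != p -> y != p ->
    connect (pair_rel a b) p x -> connect (pair_rel a b) p y -> x = y.
Proof.
have half z : b z = z -> z != p -> connect (pair_rel a b) p z ->
    z = iter n./2 g p.
  move=> bz zp /reach[k zk].
   have /iter_findex li : fconnect g p z.
    by rewrite zk fconnect_iter.
  have lt : findex g p z < n by apply: findex_max; rewrite zk fconnect_iter.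
  case: (fixed_iter lt) => [|i0|<-]; first by rewrite li.
    by case/eqP: zp; rewrite -li i0.
  by rewrite doubleK li.
by move=> bx by_ xp yp /(half _ bx xp)-> /(half _ by_ yp)->.
Qed.

Lemma partner_exists :
  exists q, [/\ q != p, b q = q & connect (pair_rel a b) p q].
Proof.
have conn i : connect (pair_rel a b) p (iter i g p).
  elim: i => [|i IHi]; first exact: connect0.
  apply: connect_trans IHi _; apply: (@connect_trans _ _ (b (iter i g p))).
    by apply: connect1; rewrite /pair_rel /= eqxx orbT.
  by apply: connect1; rewrite /pair_rel /= eqxx.
have injg k : injective (iter k g) by elim: k => //= k IHk x y /gI/IHk.
have gn : iter n g p = p by apply: iter_order.
(* For [n = m.*2.+1], [b] exchanges the points of exponents [m] and [m.+1]; as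
   [g = a \o b] sends the first to the second, [a] fixes the second. *)
set m := n./2; case on: (odd n).
  case/eqP: (aN (b (iter m g p))); rewrite -[LHS]/(iter m.+1 g p).
  apply: (injg m); rewrite b_iter -iterD addnS addnn -add1n.
  by rewrite -[X in X + _]/(true : nat) -on odd_double_half.
have n2 : m.*2 = n by rewrite -[RHS]odd_double_half on.
have m0 : 0 < m by rewrite -double_gt0 n2 order_gt0.
have mn : m < n by rewrite -n2 -addnn -[X in X < _]addn0 ltn_add2l.
exists (iter m g p); split=> //.
  apply/eqP => mp; have := findex_iter mn.
  by rewrite mp findex0 => m0'; rewrite -m0' in m0.
by apply: (injg m); rewrite b_iter -iterD addnn n2.
Qed.

End Partner.
End Components.

(** * The three resolutions of an edge *)

Section EdgeResolutions.
Variable E : finType.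
Implicit Types (c d : corner E) (F : {set E}) (w : bool * bool).
Local Open Scope nat_scope.

(** The Klein four-group acts simply transitively on the four corners of each
    edge; its elements other than [(false, false)] are the three perfect
    matchings of these corners: [(false, true)] is [seg_end], [(true, false)] is
    [side_end], and [(true, true)] joins them crosswise, as the free sides of a
    half-twisted edge do. *)
Definition turn w c : corner E := ((c.1.1, c.1.2 (+) w.1), c.2 (+) w.2).

(** The boundary of the subgraph [F], except that the corners of [e] are joined
    by [turn w].  For [w = (false, false)] they are left as loose ends. *)
Definition resolve F e w c : corner E :=
  if c.1.1 == e then turn w c
  else if c.1.1 \in F then side_end c else seg_end c.

Notation idle := (false, false).

Lemma turn_idle c : turn idle c = c.
Proof. by case: c => [[e i] s]; rewrite /turn !addbF. Qed.

Lemma turnD w w' c : turn w (turn w' c) = turn (w.1 (+) w'.1, w.2 (+) w'.2) c.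
Proof.
by case: c w w' => [[e []] []] [[] []] [[] []].
Qed.

Lemma turnK w : involutive (turn w).
Proof. by move=> c; rewrite turnD !addbb turn_idle. Qed.

Lemma same_edge_turn c d : c.1.1 = d.1.1 -> exists w, d = turn w c.
Proof.
case: c d => [[e i] s] [[_ j] t] /= <-.
by exists (i (+) j, s (+) t); rewrite /turn !addKb.
Qed.

Lemma turn_eq w c : (turn w c == c) = (w == idle).
Proof. by case: c w => [[e [] ] []] [[] []]; rewrite /turn /= !xpair_eqE /= eqxx. Qed.

Lemma resolveK F e w : involutive (resolve F e w).
Proof.
move=> c; rewrite /resolve; case ce: (c.1.1 == e); first by rewrite /= ce turnK.
by case: c ce => [[f i] s] /= ce; case cF: (f \in F);
  rewrite /side_end /seg_end /= ce cF negbK.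
Qed.

Lemma resolve_at F e w c : c.1.1 = e -> resolve F e w c = turn w c.
Proof. by move=> ce; rewrite /resolve ce eqxx. Qed.

Lemma resolve_idle_fixed F e c : (resolve F e idle c == c) = (c.1.1 == e).
Proof.
rewrite /resolve; case: ifP => _; first by rewrite turn_eq.
by case: ifP => _; case: c => [[f []] []];
  rewrite /side_end /seg_end !xpair_eqE /= ?andbF.
Qed.

Variables (a : corner E -> corner E) (F : {set E}) (e : E).
Hypotheses (aK : involutive a) (aN : forall c, a c != c).

Let res w := pair_rel a (resolve F e w).
Let conn w := connect (res w).

Let symC w : connect_sym (res w).
Proof. by apply: pair_rel_sym => //; apply: resolveK. Qed.

Let conn_turn w c : c.1.1 = e -> conn w c (turn w c).
Proof.
by move=> ce; apply: connect1; rewrite /res /pair_rel /= resolve_at // eqxx orbT.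
Qed.

Let idle_fix c : c.1.1 = e -> resolve F e idle c = c.
Proof. by move=> ce; apply/eqP; rewrite resolve_idle_fixed ce. Qed.

Let pair_uniq c w w' : c.1.1 = e -> w != idle -> w' != idle ->
  conn idle c (turn w c) -> conn idle c (turn w' c) -> w = w'.
Proof.
move=> ce w0 w'0 cw cw'.
have := partner_uniq aK (resolveK F e idle) (idle_fix ce)
  (idle_fix (ce : (turn w c).1.1 = e)) (idle_fix (ce : (turn w' c).1.1 = e)).
rewrite !turn_eq => /(_ w0 w'0 cw cw') /(congr1 (turn w)) /eqP.
rewrite turnK turnD eq_sym turn_eq.
by case: (w) (w') => [[] []] [[] []].
Qed.

Let partner c : c.1.1 = e -> exists2 w, w != idle & conn idle c (turn w c).
Proof.
move=> ce; have [d [dc]] := partner_exists aK (resolveK F e idle) aN (idle_fix ce).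
move=> /eqP; rewrite resolve_idle_fixed => /eqP de cd.
have [|w dw] := @same_edge_turn c d; first by rewrite ce de.
by exists w; rewrite -?dw // -(turn_eq w c) -dw.
Qed.

(* Some corner [o] is paired by [w]; if another corner had a partner other than by
   [w], then a path would have three ends. *)
Let pairing : exists2 w, w != idle &
  forall c, c.1.1 = e -> conn idle c (turn w c).
Proof.
pose o : corner E := ((e, false), false).
have [w w0 ow] := partner (erefl : o.1.1 = e); exists w => // c ce.
have [|u ->] := @same_edge_turn o c; first by rewrite ce.
have [v v0 cv] := partner (erefl : (turn u o).1.1 = e).
have [->|u0] := eqVneq u idle; first by rewrite turn_idle.
have [->|uw] := eqVneq u w; first by rewrite turnK /conn symC.
have [<-//|vw] := eqVneq v w.
have v_u : v = u \/ turn v (turn u o) = turn w o.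
  by rewrite turnD; case: (u) (v) (w) u0 uw v0 vw w0 => [[] []] [[] []] [[] []];
    auto.
case/eqP: uw; apply: (@pair_uniq o) => //.
rewrite /conn symC; case: v_u cv => [->|->]; first by rewrite turnK.
by move=> uw; apply: connect_trans uw _; rewrite symC.
Qed.

(** The pairing [w] of the four corners by the rest of the boundary gives one
    circle more than the two other resolutions, in which these corners all lie
    on one circle. *)
Lemma edge_resolutions :
  exists2 w, w != idle & forall w', w' != idle -> w' != w ->
    [/\ n_comp (res w) predT = (n_comp (res w') predT).+1,
        subrel (conn w) (conn w')
      & forall c d, c.1.1 = e -> d.1.1 = e -> conn w' c d].
Proof.
have [w w0 pw] := pairing; exists w => // w' w'0 w'w.
have base u c d : res u c d -> res idle c d \/ c.1.1 = e /\ d = turn u c.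
  rewrite /res /pair_rel /=; case/orP => [->|]; first by left.
  rewrite /resolve; case: ifP => [/eqP ce /eqP->|_ ->]; first by right.
  by left; rewrite orbT.
have sub u : subrel (conn idle) (conn u).
  apply: connect_sub => c d; rewrite /res /pair_rel /=.
  case/orP => [cd|]; first by apply: connect1; rewrite /= cd.
  rewrite /resolve; case: ifP => [ce|ce].
    by rewrite turn_idle => /eqP->; apply: connect0.
  by move=> cd; apply: connect1; rewrite /= /resolve ce cd orbT.
have sub_w : subrel (conn w) (conn idle).
  apply: connect_sub => c d /base[cd|[ce ->]]; first exact: connect1.
  exact: pw.
have all_at c d : c.1.1 = e -> d.1.1 = e -> conn w' c d.
  move=> ce de; have [|u ->] := @same_edge_turn c d; first by rewrite ce.
  have [->|u0] := eqVneq u idle; first by rewrite turn_idle; apply: connect0.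
  have [->|uw] := eqVneq u w; first exact/sub/pw.
  have [->|uw'] := eqVneq u w'; first exact: conn_turn.
  have -> : turn u c = turn w' (turn w c).
    rewrite turnD; congr turn.
    by case: (u) (w) (w') u0 uw uw' w0 w'0 w'w => [[] []] [[] []] [[] []].
  apply: connect_trans (sub _ _ _ (pw _ ce)) _.
  exact: conn_turn.
split=> // [|c d /sub_w/sub//].
pose o : corner E := ((e, false), false).
rewrite (_ : n_comp (res w) _ = n_comp (res idle) predT); last first.
  apply: eq_n_comp => c d; apply/idP/idP; first exact: sub_w.
  exact: sub.
have npq : ~~ conn idle o (turn w' o).
  apply: contraNN w'w => ow'; apply/eqP; apply: (@pair_uniq o) => //.
  exact: pw.
apply: (@n_comp_merge _ _ _ o (turn w' o)) => //.
- by move=> c d cd; apply: sub; apply: connect1.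
- exact: all_at.
have near c : c.1.1 = e -> conn idle o c || conn idle (turn w' o) c.
  move=> ce; have [|u ->] := @same_edge_turn o c; first by rewrite ce.
  have [->|u0] := eqVneq u idle; first by rewrite turn_idle /conn connect0.
  have [->|uw] := eqVneq u w; first by rewrite pw.
  have [->|uw'] := eqVneq u w'; first by rewrite /conn connect0 orbT.
  have -> : turn u o = turn w (turn w' o).
    rewrite turnD; congr turn.
    by case: (u) (w) (w') u0 uw uw' w0 w'0 w'w => [[] []] [[] []] [[] []].
  by rewrite pw ?orbT.
move=> c d /base[cd|[ce ->]]; first by left; apply: connect1.
by right; split; apply: near.
Qed.

End EdgeResolutions.

(** * Boundary components and feasible sets *)

Section Boundary.
Variables V E : finType.
Implicit Types (G : ribbon_graph V E) (A F : {set E}) (e : E).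
Implicit Types (b : corner E -> corner E) (c d : corner E) (v : V).
Local Open Scope nat_scope.

Definition bdry_end F c := if c.1.1 \in F then side_end c else seg_end c.

Lemma bdry_endK F : involutive (bdry_end F).
Proof.
case=> [[e i] s]; rewrite /bdry_end /=.
by case eF: (e \in F); rewrite /side_end /seg_end /= eF negbK.
Qed.

Lemma sub_bdry_sym G F : connect_sym (sub_bdry G F).
Proof. exact: pair_rel_sym (varcK G) (bdry_endK F). Qed.

Lemma bdry_end_del F e : bdry_end (F :\ e) =1 resolve F e (false, true).
Proof.
case=> [[f i] s]; rewrite /bdry_end /resolve !inE /=.
by case: eqP => //= _; rewrite /seg_end /turn /= addbF addbT.
Qed.

Lemma bdry_end_mem F e : e \in F -> bdry_end F =1 resolve F e (true, false).
Proof.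
move=> eF [[f i] s]; rewrite /bdry_end /resolve /=.
by case: eqP => [->|//]; rewrite eF /side_end /turn /= addbF addbT.
Qed.

Lemma flip_bdry_end_mem F e : e \in F ->
  flip [set e] \o bdry_end F \o flip [set e] =1 resolve F e (true, true).
Proof.
move=> eF [[f i] s]; rewrite /bdry_end /resolve /flip /= !inE.
case: (eqVneq f e) => [->|/negPf fe] /=; last first.
  by case: ifP => _; rewrite /side_end /seg_end /= fe.
by rewrite eF eqxx /turn; case: i s => [] [].
Qed.

Lemma flip_bdry_end_notin F e : e \notin F ->
  flip [set e] \o bdry_end F \o flip [set e] =1 bdry_end F.
Proof.
move=> eF [[f i] s]; rewrite /bdry_end /flip /= !inE.
case: (eqVneq f e) => [->|/negPf fe] /=; last first.
  by case: ifP => _; rewrite /side_end /seg_end /= fe.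
by rewrite (negPf eF) /seg_end /= eqxx; case: i s => [] [].
Qed.

(** The number of boundary components when the ends of the vertex arcs are joined
    by [b]. *)
Definition circles G b := n_comp (pair_rel (varc G) b) predT
  + #|[set v | v \notin codom (vertex G)]|.

Definition total_bdry G F := circles G (bdry_end F).

Lemma eq_circles G b b' : b =1 b' -> circles G b = circles G b'.
Proof.
move=> bb; rewrite /circles (@eq_n_comp _ _ (pair_rel (varc G) b')) //.
by apply: eq_connect => c d; rewrite /pair_rel /= bb.
Qed.

Lemma sub_num_bdry_setT G F : sub_num_bdry G [set: V] F = total_bdry G F.
Proof.
rewrite /sub_num_bdry /total_bdry /circles.
have -> : [set v in [set: V] | v \notin codom (vertex G)]
          = [set v | v \notin codom (vertex G)].
  by apply/setP => v; rewrite !inE.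
by rewrite (@eq_n_comp_r _ _ _ predT) // => c; rewrite !inE.
Qed.

Lemma eq_total_bdry G G' F : vertex G =1 vertex G' -> varc G =1 varc G' ->
  total_bdry G F = total_bdry G' F.
Proof.
move=> gv ga; rewrite /total_bdry /circles.
have -> : [set v | v \notin codom (vertex G)] = [set v | v \notin codom (vertex G')].
  by apply/setP=> v; rewrite !inE (eq_codom gv).
rewrite (@eq_n_comp _ _ (pair_rel (varc G') (bdry_end F))) //.
by apply: eq_connect => c d; rewrite /pair_rel /= ga.
Qed.

(** Renaming the corners by [flip A] restores the vertex arcs of [G] and moves
    the half-twists from the vertices to the sides of the edges. *)
Lemma total_bdry_petrial G A F :
  total_bdry (partial_petrial G A) F = circles G (flip A \o bdry_end F \o flip A).
Proof.
rewrite /total_bdry /circles /=.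
set r := pair_rel (varc G) _; set r' := pair_rel (petrial_arc G A) _.
rewrite (@n_comp_conj _ (flip A) r r') //.
- apply: pair_rel_sym; first exact: varcK.
  by move=> c /=; rewrite flipK bdry_endK flipK.
- exact: sub_bdry_sym (partial_petrial G A) F.
- exact: flipK.
move=> c d; rewrite /r /r' /pair_rel /= /petrial_arc.
by rewrite !(inv_eq (flipK A)) !flipK.
Qed.

Lemma total_bdry_petrial_notin G F e : e \notin F ->
  total_bdry (partial_petrial G [set e]) F = total_bdry G F.
Proof.
by move=> eF; rewrite total_bdry_petrial (eq_circles _ (flip_bdry_end_notin eF)).
Qed.

Lemma total_bdry_local G F e : e \in F -> exists n,
  let f := [:: total_bdry G F; total_bdry G (F :\ e);
               total_bdry (partial_petrial G [set e]) F] in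
  [\/ f = [:: n.+1; n; n], f = [:: n; n.+1; n] | f = [:: n; n; n.+1]].
Proof.
move=> eF; rewrite total_bdry_petrial (eq_circles _ (flip_bdry_end_mem eF)).
rewrite /total_bdry (eq_circles _ (bdry_end_mem eF)) (eq_circles _ (bdry_end_del F e)).
have [w w0 W] := edge_resolutions F e (varcK G) (varc_neq G).
pose f u := circles G (resolve F e u).
have {}W w' : w' != (false, false) -> w' != w -> f w = (f w').+1.
  by move=> w'0 w'w; have [h _ _] := W w' w'0 w'w; rewrite /f /circles h addSn.
rewrite -/(f (true, false)) -/(f (false, true)) -/(f (true, true)).
move: f W => f W /=.
case: w w0 W => [[] []] // _ W.
- exists (f (true, false)); constructor 3.
  have E1 := W (true, false) isT isT; have := W (false, true) isT isT.
  by rewrite E1 => -[<-].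
- exists (f (true, true)); constructor 1.
  have E1 := W (true, true) isT isT; have := W (false, true) isT isT.
  by rewrite E1 => -[<-].
- exists (f (true, true)); constructor 2.
  have E1 := W (true, true) isT isT; have := W (true, false) isT isT.
  by rewrite E1 => -[<-].
Qed.

(** If [e] has two different boundary components along its sides, then the
    rest of the boundary pairs the corners of [e] as its free sides do, so the
    deletion of [e] merges the two components. *)
Lemma total_bdry_del G F e : e \in F ->
  (exists2 c, c.1.1 = e & ~~ connect (sub_bdry G F) c (seg_end c)) ->
  [/\ total_bdry G F = (total_bdry G (F :\ e)).+1,
      subrel (connect (sub_bdry G F)) (connect (sub_bdry G (F :\ e)))
    & forall c d, c.1.1 = e -> d.1.1 = e -> connect (sub_bdry G (F :\ e)) c d].
Proof.
move=> eF [c ce ncc].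
have [w w0 W] := edge_resolutions F e (varcK G) (varc_neq G).
have cF : connect (pair_rel (varc G) (resolve F e (true, false)))
          =2 connect (sub_bdry G F).
  by apply: eq_connect => x y; rewrite /pair_rel /sub_bdry /= -(bdry_end_mem eF).
have cFe : connect (pair_rel (varc G) (resolve F e (false, true)))
          =2 connect (sub_bdry G (F :\ e)).
  by apply: eq_connect => x y; rewrite /pair_rel /sub_bdry /= -(bdry_end_del F e).
have wE : w = (true, false).
  apply/eqP; apply: contraNT ncc => w_side.
  have [|_ _ all_e] := W (true, false) isT; first by rewrite eq_sym.
  by rewrite -cF; apply: all_e.
move: W; rewrite wE => /(_ (false, true) isT isT)[n_del sub all_e].
split=> [||x y xe ye]; last by rewrite -cFe; apply: all_e.
  rewrite /total_bdry (eq_circles _ (bdry_end_mem eF)).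
  by rewrite (eq_circles _ (bdry_end_del F e)) /circles n_del addSn.
by move=> x y; rewrite -cF -cFe; apply: sub.
Qed.

Lemma adjacent_sym G : connect_sym (adjacent G).
Proof.
apply: sym_connect_sym => v w.
by apply/existsP/existsP => -[h /andP[vh wh]]; exists (h.1, ~~ h.2);
  rewrite /= negbK -surjective_pairing wh vh.
Qed.

Lemma sub_bdry_component G F c d : connect (sub_bdry G F) c d ->
  connect (adjacent G) (vertex G c.1) (vertex G d.1).
Proof.
suff step x y : sub_bdry G F x y ->
    connect (adjacent G) (vertex G x.1) (vertex G y.1).
  case/connectP=> p; elim: p c => [|x p IHp] c /= => [_ ->|/andP[cx px] dx].
    exact: connect0.
  exact: connect_trans (step _ _ cx) (IHp _ px dx).
case/orP => /eqP->.
  have -> : vertex G (varc G x).1 = vertex G x.1; last exact: connect0.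
  by apply/esym/eqP; rewrite vertexP; apply: connect1; rewrite /vertex_bdry /= eqxx orbT.
case: ifP => _; last exact: connect0.
by apply: connect1; apply/existsP; exists x.1; rewrite !eqxx.
Qed.

Lemma component_isolated G v w : v \notin codom (vertex G) ->
  connect (adjacent G) v w -> w = v.
Proof.
move=> vG /connectP[[|u p] /=]; first by move=> _ ->.
case/andP => /existsP[h /andP[/eqP vh _]].
by case/negP: vG; rewrite -vh codom_f.
Qed.

Lemma sub_num_bdry_gt0 G F v : 0 < sub_num_bdry G (component G v) F.
Proof.
rewrite /sub_num_bdry addn_gt0.
have [/codomP[h vh]|vG] := boolP (v \in codom (vertex G)); last first.
  by apply/orP; right; apply/card_gt0P; exists v; rewrite !inE connect0.
apply/orP; left; apply/card_gt0P.
exists (fingraph.root (sub_bdry G F) (h, false)).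
rewrite !inE roots_root //=; last exact: sub_bdry_sym.
by rewrite vh; apply: (@sub_bdry_component _ F (h, false)); apply: connect_root.
Qed.

Lemma num_componentsE G :
  num_components G = #|[pred v | v \in roots (adjacent G)]|.
Proof. by apply: eq_card => v; rewrite !inE andbT. Qed.

Lemma total_bdry_sum G F :
  total_bdry G F = \sum_(v in roots (adjacent G)) sub_num_bdry G (component G v) F.
Proof.
have se := adjacent_sym G.
rewrite /total_bdry /circles /sub_num_bdry big_split /=; congr addn.
  rewrite /n_comp_mem -sum1_card.
  rewrite (partition_big (fun c => fingraph.root (adjacent G) (vertex G c.1))
    [in roots (adjacent G)]) => [|c _]; last exact: roots_root.
  apply: eq_bigr => v rv; rewrite sum1_card; apply: eq_card => c.
  rewrite !inE unfold_in /= !inE andbT /=; congr (_ && _).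
  by rewrite -[X in _ == X](eqP rv) root_connect // se.
rewrite -sum1_card (partition_big (fingraph.root (adjacent G))
    [in roots (adjacent G)]) => [|c _]; last exact: roots_root.
apply: eq_bigr => v rv; rewrite sum1_card; apply: eq_card => w.
rewrite !inE unfold_in /= !inE andbC /=; congr (_ && _).
by rewrite -[X in _ == X](eqP rv) root_connect // se.
Qed.

(** The boundary of each component of [G] is not empty, and [F] is feasible iff
    it is always a single circle. *)
Lemma feasible_leqif G F :
  num_components G <= total_bdry G F ?= iff (F \in delta_matroid_of G).
Proof.
rewrite num_componentsE total_bdry_sum -sum1_card inE.
have -> : [forall v, sub_num_bdry G (component G v) F == 1]
    = [forall (v | v \in roots (adjacent G)), 1 == sub_num_bdry G (component G v) F].
  apply/forallP/forall_inP => [one v _|one v]; first by rewrite eq_sym.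
  rewrite eq_sym (_ : component G v = component G (fingraph.root (adjacent G) v)).
    exact/one/roots_root/adjacent_sym.
  apply/setP => w; rewrite !inE.
  exact/(same_connect (adjacent_sym G))/connect_root.
by apply: leqif_sum => v _; split=> //; apply: sub_num_bdry_gt0.
Qed.

Lemma feasibleE G F :
  (F \in delta_matroid_of G) = (total_bdry G F == num_components G).
Proof. by rewrite eq_sym (feasible_leqif G F).2. Qed.

(** Vertex arcs and segments connect all corners of a vertex, free sides connect
    adjacent vertices; so each component has a single boundary circle. *)
Lemma glued_feasible G F :
    (forall c, connect (sub_bdry G F) c (seg_end c)) ->
    (forall c, connect (sub_bdry G F) c (side_end c)) ->
  F \in delta_matroid_of G.
Proof.
move=> seg side; rewrite inE; apply/forallP => v.
have cs := sub_bdry_sym G F.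
have same_vertex c d : vertex G c.1 = vertex G d.1 -> connect (sub_bdry G F) c d.
  move/eqP; rewrite vertexP; move: c d; apply: connect_sub => c d /orP[]/eqP-> //.
  by apply: connect1; rewrite /sub_bdry /= eqxx.
have adj u w c d : connect (adjacent G) u w -> vertex G c.1 = u ->
    vertex G d.1 = w -> connect (sub_bdry G F) c d.
  case/connectP=> p; elim: p u c => [|x p IHp] u c /=.
    by move=> _ -> cu dw; apply: same_vertex; rewrite cu.
  case/andP => /existsP[h /andP[/eqP hu /eqP hx]] px wx cu dw.
  apply: connect_trans (IHp x ((h.1, ~~ h.2), false) px wx hx dw).
  apply: connect_trans (side (h, false)).
  by apply: same_vertex; rewrite cu.
have [/codomP[h vh]|vG] := boolP (v \in codom (vertex G)); last first.
  rewrite /sub_num_bdry (@eq_n_comp_r _ _ _ pred0) => [|c]; last first.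
    rewrite !inE; apply/negP => /(component_isolated vG) cv.
    by case/negP: vG; rewrite -cv codom_f.
  rewrite /n_comp_mem [X in X + _](_ : _ = 0); last first.
    by apply: eq_card0 => c; rewrite !inE andbF.
  rewrite add0n; apply/cards1P; exists v; apply/setP => w; rewrite !inE.
  apply/andP/eqP => [[/(component_isolated vG)//]|->].
  by rewrite connect0.
rewrite /sub_num_bdry (_ : [set w in _ | _] = set0) ?cards0 ?addn0; last first.
  apply/setP => w; rewrite !inE; apply/negP => /andP[vw wG].
  case/negP: (wG); rewrite -(component_isolated wG (w := v)) ?vh ?codom_f //.
  by rewrite adjacent_sym -vh.
rewrite -(n_comp_connect cs (h, false)); apply/eqP/eq_n_comp_r => c; rewrite !inE.
apply/idP/idP => [vc|/sub_bdry_component]; last by rewrite vh.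
by apply: (adj v (vertex G c.1)).
Qed.

(** Each deletion of an edge with two different boundary components along its
    sides loses one boundary component.  The four corners of the deleted edge
    are then connected and remain so, as deletions of this kind only merge
    components.  This invariant is what makes the final set feasible: it says
    that deleted edges do not separate boundary components either. *)
Lemma feasible_greedy G F :
    (forall e c d, e \notin F -> c.1.1 = e -> d.1.1 = e ->
       connect (sub_bdry G F) c d) ->
  exists2 B, B \in delta_matroid_of G &
    total_bdry G F + #|B| = num_components G + #|F|.
Proof.
have [n le_n] := ubnP #|F|; elim: n F le_n => // n IHn F le_n out.
have [/existsP[c /andP[cF ncc]]|] :=
  boolP [exists c, (c.1.1 \in F) && ~~ connect (sub_bdry G F) c (seg_end c)].
  have [|bF sub all_e] := total_bdry_del cF (G := G); first by exists c.
  have cardF := cardsD1 c.1.1 F; rewrite cF in cardF.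
  have [|e x y|B BD BE] := IHn (F :\ c.1.1).
  - by rewrite -ltnS (leq_trans _ le_n) // cardF.
  - rewrite !inE negb_and negbK => /orP[/eqP->|eF xe ye]; first exact: all_e.
    exact/sub/(out e).
  by exists B; rewrite // bF cardF addSn BE addnCA.
rewrite negb_exists => /forallP glued.
have seg c : connect (sub_bdry G F) c (seg_end c).
  have := glued c; rewrite negb_and negbK => /orP[cF|//].
  exact: (out c.1.1).
have side c : connect (sub_bdry G F) c (side_end c).
  have [cF|cF] := boolP (c.1.1 \in F); last exact: (out c.1.1).
  by apply: connect1; rewrite /sub_bdry /= cF eqxx orbT.
have FD := glued_feasible seg side.
by exists F => //; move: FD; rewrite feasibleE => /eqP->.
Qed.

(** By [total_bdry_local], the addition of an edge creates at most one boundary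
    component. *)
Lemma total_bdry_setT_le G F : total_bdry G [set: E] + #|F| <= total_bdry G F + #|E|.
Proof.
have [n le_n] := ubnP #|~: F|; elim: n F le_n => // n IHn F le_n.
have [/(congr1 (@setC _))|[e]] := set_0Vmem (~: F).
  by rewrite setCK setC0 => ->; rewrite cardsT.
rewrite inE => eF; have cardU : #|e |: F| = #|F|.+1 by rewrite cardsU1 eF.
have lt : #|~: (e |: F)| < n.
  have := cardsC F; rewrite -(cardsC (e |: F)) cardU addSnnS => /addnI h.
  by rewrite -ltnS -h.
have step : total_bdry G (e |: F) <= (total_bdry G F).+1.
  have [m /=] := total_bdry_local G (setU11 e F); rewrite (setU1K eF).
  by case=> -[-> -> _]; rewrite ?leqnn // ltnW // ltnW.
have arith x y z k m : x + k.+1 <= y + m -> y <= z.+1 -> x + k <= z + m.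
  rewrite addnS => lt_xy yz; rewrite -ltnS; apply: leq_trans lt_xy _.
  by rewrite -addSn leq_add2r.
by have := IHn _ lt; rewrite cardU => /arith/(_ step).
Qed.

Lemma num_components_petrial G A :
  num_components (partial_petrial G A) = num_components G.
Proof. by []. Qed.

(** The rule for the feasible sets of a loop complementation at [e]: by
    [total_bdry_local], either none or exactly two of the three boundaries have
    the minimal number of components. *)
Lemma mem_petrial1 G e F :
  (F \in delta_matroid_of (partial_petrial G [set e]))
  = (F \in delta_matroid_of G) (+) (e \in F) && (F :\ e \in delta_matroid_of G).
Proof.
have [eF|eF] /= := boolP (e \in F); last first.
  rewrite addbF; apply: etrans (feasibleE _ _) _.
  by rewrite (total_bdry_petrial_notin G eF) num_components_petrial feasibleE.
have le_k X : num_components G <= total_bdry G X := (feasible_leqif G X).1.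
have le_k' : num_components G <= total_bdry (partial_petrial G [set e]) F.
  exact: (feasible_leqif (partial_petrial G [set e]) F).1.
apply: etrans (feasibleE _ _) _; rewrite num_components_petrial.
rewrite (feasibleE G F) (feasibleE G (F :\ e)).
have [n /=] := total_bdry_local G eF.
have := le_k F; have := le_k (F :\ e); move: le_k'.
move: (total_bdry _ _) (total_bdry _ _) (total_bdry _ _) (num_components G).
move=> x y z k kx ky kz.
by case=> -[ez ey ex]; move: kx ky kz; rewrite ex ey ez => kx ky kz;
  rewrite ?[n.+1 == k]gtn_eqF ?ltnS //; case: (n == k).
Qed.

End Boundary.

(** * Twists and loop complementations *)

Section SetSystems.
Variable E : finType.
Implicit Types (D : {set {set E}}) (A B F X : {set E}) (e : E).
Local Open Scope nat_scope.

Lemma in_symdiff (T : finType) (A B : {set T}) x :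
  (x \in symdiff A B) = (x \in A) (+) (x \in B).
Proof. by rewrite !inE; case: (x \in A) (x \in B) => [] []. Qed.

Lemma symdiffK A : involutive (symdiff A).
Proof. by move=> B; apply/setP => x; rewrite !in_symdiff addKb. Qed.

Lemma symdiffA A B F : symdiff A (symdiff B F) = symdiff (symdiff A B) F.
Proof. by apply/setP => x; rewrite !in_symdiff addbA. Qed.

Lemma mem_twist D A F : (F \in twist D A) = (symdiff A F \in D).
Proof.
apply/imsetP/idP => [[X XD ->]|FD]; first by rewrite symdiffK.
by exists (symdiff A F); rewrite ?symdiffK.
Qed.

Lemma twist_twist D A B : twist (twist D A) B = twist D (symdiff A B).
Proof. by apply/setP => F; rewrite !mem_twist symdiffA. Qed.

Lemma mem_loop_compl1 D e F :
  (F \in loop_compl1 D e) = (F \in D) (+) (e \in F) && (F :\ e \in D).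
Proof.
rewrite in_symdiff; congr (_ (+) _); apply/imsetP/andP => [[X]|[eF FeD]].
  by rewrite inE => /andP[XD eX] ->; rewrite setU11 setU1K.
by exists (F :\ e); rewrite ?setD1K // inE FeD setD11.
Qed.

Lemma loop_compl1_twist D A e : e \notin A ->
  loop_compl1 (twist D A) e = twist (loop_compl1 D e) A.
Proof.
move=> eA; apply/setP => F.
rewrite mem_twist !mem_loop_compl1 !mem_twist in_symdiff (negPf eA) /=.
have -> // : symdiff A (F :\ e) = symdiff A F :\ e.
apply/setP => x; rewrite !(in_symdiff, in_setD1).
by have [->|//] := eqVneq x e; rewrite (negPf eA).
Qed.

Lemma loop_compl_twist D A X : [disjoint X & A] ->
  loop_compl (twist D A) X = twist (loop_compl D X) A.
Proof.
move=> XA; rewrite /loop_compl.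
have: all [predC A] (enum X).
  by apply/allP => e; rewrite mem_enum inE => eX; rewrite /= (disjointFr XA eX).
elim: (enum X) D => //= e s IHs D /andP[eA sA].
by rewrite loop_compl1_twist // IHs.
Qed.

(** The twists by [X] around the loop complementation cancel those within the
    twist by [E]; the twist by the complement of [X] commutes with [+ X]. *)
Lemma dual_pivot_twistT D X :
  dual_pivot (twist D [set: E]) X = twist (loop_compl D X) [set: E].
Proof.
rewrite /dual_pivot twist_twist.
have -> : symdiff [set: E] X = ~: X by apply/setP => x; rewrite in_symdiff !inE.
rewrite loop_compl_twist ?twist_twist; last by rewrite -setI_eq0 setICr.
by congr twist; apply/setP => x; rewrite in_symdiff !inE; case: (x \in X).
Qed.

Lemma min_rankE D F : F \in D -> (forall X, X \in D -> #|F| <= #|X|) ->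
  min_rank D = #|F|.
Proof.
move=> FD minF; apply/eqP; rewrite eqn_leq /min_rank; apply/andP; split.
  have: F \in index_enum {set E} by rewrite mem_index_enum.
  elim: (index_enum _) => // X s IHs; rewrite inE big_cons.
  case/orP => [/eqP<-|/IHs le_s]; first by rewrite FD geq_min leqnn.
  by case: ifP => // _; rewrite geq_min le_s orbT.
apply: (big_ind (fun m => #|F| <= m)) => [|x y lx ly|X /minF//]; first exact: max_card.
by rewrite leq_min lx.
Qed.

End SetSystems.


(** * The exponents of the two polynomials *)

Section PenrosePolynomials.
Variables V E : finType.
Implicit Types (G : ribbon_graph V E) (A B F : {set E}) (e : E).
Local Open Scope nat_scope.

Lemma eq_delta_matroid_of G G' : vertex G =1 vertex G' -> varc G =1 varc G' ->
  delta_matroid_of G = delta_matroid_of G'.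
Proof.
move=> gv ga; apply/setP => F.
apply: etrans (feasibleE G F) _; apply: etrans (esym (feasibleE G' F)).
rewrite (eq_total_bdry F gv ga); congr (_ == _); apply: eq_n_comp.
by apply: eq_connect => v w; rewrite /adjacent /=; apply: eq_existsb => h; rewrite !gv.
Qed.

Lemma loop_compl_delta_matroid G A :
  loop_compl (delta_matroid_of G) A = delta_matroid_of (partial_petrial G A).
Proof.
rewrite /loop_compl -{2}[A]set_enum; have := enum_uniq A.
elim/last_ind: (enum A) => [_|s e IHs]; rewrite /= ?rcons_uniq.
  apply: eq_delta_matroid_of => // c; rewrite /= /petrial_arc.
  by rewrite /flip !inE /= -!surjective_pairing.
case/andP => es us; rewrite foldl_rcons IHs //; apply/setP => F.
rewrite mem_loop_compl1; apply: etrans (esym (mem_petrial1 _ _ _)) _.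
suff -> : delta_matroid_of (partial_petrial (partial_petrial G [set x in s]) [set e])
   = delta_matroid_of (partial_petrial G [set x in rcons s e]) by [].
have flips c : flip [set x in s] (flip [set e] c) = flip [set x in rcons s e] c.
  case: c => [[f i] t]; rewrite /flip /= !inE mem_rcons inE.
  have [->|fe] //= := eqVneq f e; rewrite (negPf es); by case: i.
have flips' c : flip [set e] (flip [set x in s] c) = flip [set x in rcons s e] c.
  by rewrite -flips; case: c => [[f i] t]; rewrite /flip /=; do 2!case: ifP.
by apply: eq_delta_matroid_of => // c; rewrite /= /petrial_arc /= /petrial_arc flips flips'.
Qed.

(** The feasible sets of the twist are the complements of those of [D(G)], so its
    rank is the number of edges missed by a largest feasible set. *)
Lemma min_rank_dual G :
  total_bdry G [set: E]
  = num_components G + min_rank (twist (delta_matroid_of G) [set: E]).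
Proof.
have symT F : symdiff [set: E] F = ~: F by apply/setP => x; rewrite in_symdiff !inE.
have [|B BD BE] := @feasible_greedy V E G [set: E]; first by move=> e c d; rewrite inE.
rewrite cardsT -(cardsC B) addnCA [RHS]addnC in BE.
move/addIn: BE => BE; rewrite BE; congr addn; symmetry; apply: min_rankE.
  by rewrite mem_twist symT setCK.
move=> X; rewrite mem_twist symT => XD.
have := total_bdry_setT_le G (~: X).
move: XD; rewrite feasibleE => /eqP->.
by rewrite BE -(cardsC X) addnA leq_add2r leq_add2l.
Qed.

End PenrosePolynomials.

Local Open Scope ring_scope.

Theorem theorem5p1 (V E : finType) (G : ribbon_graph V E) :
  penrose_ribbon G = 'X^(num_components G) * penrose_delta (delta_matroid_of G).
Proof.
rewrite /penrose_delta GRing.mulr_sumr; apply: eq_bigr => A _.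
rewrite dual_pivot_twistT loop_compl_delta_matroid /num_bdry sub_num_bdry_setT.
by rewrite min_rank_dual num_components_petrial GRing.exprD GRing.mulrCA.
Qed.
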